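(* Let $0<\varepsilon\le\frac1{24}$, let $n,k$ be positive integers with $n\ge k/\varepsilon$, and let $\mathcal F\subset\binom{[n]}{k}$ be a nonempty intersecting family with $|\mathcal F|\ge 48\binom{n-3}{k-3}$. Then $\varrho(\mathcal F)>\frac23-\varepsilon$.
   Context: A family $\mathcal F$ is intersecting if $F\cap F'\neq\emptyset$ for all $F,F'\in\mathcal F$. For $i\in[n]$, $\mathcal F(i)=\{F\setminus\{i\}: i\in F\in\mathcal F\}$, and $\varrho(\mathcal F)=\max_{i\in[n]}|\mathcal F(i)|/|\mathcal F|$. *)

(* Defs.v *)
From mathcomp Require Import all_boot all_order all_algebra.
Set Implicit Arguments. Unset Strict Implicit. Unset Printing Implicit Defensive.
Import Order.TTheory GRing.Theory Num.Theory.

Definition intersecting (n : nat) (F : {set {set 'I_n}}) : Prop :=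
  forall A B, A \in F -> B \in F -> A :&: B != set0.

Definition uniform (n k : nat) (F : {set {set 'I_n}}) : Prop :=
  forall A, A \in F -> #|A| = k.

Definition link (n : nat) (F : {set {set 'I_n}}) (i : 'I_n) : {set {set 'I_n}} :=
  [set A :\ i | A in F & i \in A].

Definition rho (R : realFieldType) (n : nat) (F : {set {set 'I_n}}) : R :=
  (\big[Order.max/0%R]_(i < n) ((#|link F i|)%:R / (#|F|)%:R))%R.

Definition binom_m3 (n k : nat) : nat := if k < 3 then 0 else 'C(n - 3, k - 3).

(* Main.v *)
Require Import Defs.
From mathcomp Require Import all_boot all_order all_algebra.
From mathcomp Require Import zify lra.
Import Order.TTheory GRing.Theory Num.Theory.

Set Implicit Arguments.
Unset Strict Implicit.
Unset Printing Implicit Defensive.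

(** Write [u] for C(n-3,k-3) and call a pair [x], [y] heavy when more than [4u] members
    of the family contain both.  If all degrees are at most [(2/3 - eps)|F|], then every
    vertex is avoided by more than [16u] members; only [12u] is used.

    - If [x], [y] is heavy, at most C(n-2,k-4) members avoid both: shift the family on the
      other vertices and compare walks, counting by the reflection principle.
    - A heavy pair extends to a heavy triangle [x], [y], [v].  In a family shifted outside
      [x], [y] without such a [v] one of the cross-intersecting families F(x, not y),
      F(y, not x) would be tiny.  The first shift creating a heavy pair [x], [i] creates
      one with at most [8u] members, which is again too few.
    - Some pair is heavy.  Otherwise shift as long as every vertex is still avoided by more
      than [12u] members; no heavy pair appears, because one edge of a heavy triangle of
      the shifted family is heavy in the original one.  A fully shifted family is
      impossible, so a shift gets stuck at some [x], [y] avoided by at most [12u] members;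
      continue outside [x], [y].  Two disjoint stuck pairs leave [24u] members meeting
      both, so one of four pairs is heavy; and a family shifted outside [x], [y] has at
      most [34u] members.
    - In a heavy triangle almost all members contain two of the three vertices, so the
      three degrees add up to at least [2|F| - 3 C(n-2,k-4)], which exceeds
      [(2 - 3 eps)|F|]. *)

(** * Binomial estimates for [n >= 24k] *)

(** C(N, k - a), read as 0 when [k < a], where truncated subtraction would give 1. *)
Definition cb (N k a : nat) : nat := if k < a then 0 else 'C(N, k - a).

Lemma cb_leq (N M k a : nat) : N <= M -> cb N k a <= cb M k a.
Proof. by move=> NM; rewrite /cb; case: ifP => // _; apply: leq_bin2l. Qed.

Lemma cb_n2k3 (n k : nat) : 24 * k <= n -> cb (n - 2) k 3 <= 2 * cb (n - 3) k 3.
Proof.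
rewrite /cb; case: ltnP => // k3 nk.
have -> : n - 2 = (n - 3).+1 by lia.
have := mul_bin_down (n - 3).+1 (k - 3); rewrite /=.
set c := 'C(_, _); set d := 'C(_, _).
have -> : ((n - 3).+1 - (k - 3)) = (n - k).+1 by lia.
nia.
Qed.

(** The factor [k / n] gained here is what turns into [eps] at the very end. *)
Lemma cb_n2k4 (n k : nat) :
  24 * k <= n -> n * cb (n - 2) k 4 <= 3 * k * cb (n - 3) k 3.
Proof.
rewrite /cb; case: ltnP => [_|k4 nk]; first by rewrite muln0.
rewrite ifN; last by lia.
have -> : n - 2 = (n - 3).+1 by lia.
have := mul_bin_down (n - 3).+1 (k - 4); have := mul_bin_left (n - 3) (k - 4).
have -> : (k - 4).+1 = k - 3 by lia.
rewrite /=; set c := 'C(_, _); set d := 'C(_, _); set e := 'C(_, _).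
have -> : (n - 3).+1 - (k - 4) = n - k + 2 by lia.
have -> : n - 3 - (k - 4) = n - k + 1 by lia.
move=> dE eE.
(* The ratios (n-2)/(n-k+2) and n/(n-k+1) are at most 12/11 since [24k <= n]; their product stays
   below 3. *)
have eLd : 11 * e <= 12 * d by nia.
have dLc : 11 * n * d <= 12 * k * c by nia.
nia.
Qed.

Lemma cb_n2k4_leq (n k : nat) : 0 < k -> 24 * k <= n -> cb (n - 2) k 4 <= cb (n - 3) k 3.
Proof. by move=> k0 nk; have := cb_n2k4 nk; nia. Qed.

Lemma card_leq_cb (n : nat) (G : {set {set 'I_n}}) (V : {set 'I_n})
    (f : {set 'I_n} -> {set 'I_n}) (k a : nat) :
  {in G &, injective f} ->
  (forall A, A \in G -> f A \subset V /\ #|f A| + a = k) ->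
  #|G| <= cb #|V| k a.
Proof.
move=> finj fG; rewrite /cb; case: ltnP => [ka|ka].
  rewrite leqn0 cards_eq0; apply/eqP/setP=> A; rewrite inE.
  by apply/negP=> /fG[_]; lia.
rewrite -(card_in_imset finj) -cards_draws; apply/subset_leq_card/subsetP.
by move=> _ /imsetP[A AG ->]; have [sV fk] := fG _ AG; rewrite inE sV -fk addnK /=.
Qed.

(** * Walks and the reflection principle *)

Definition below (n : nat) (V : {set 'I_n}) (t : nat) : {set 'I_n} :=
  [set i in V | i < t].

(** The walk that steps up at the elements of [A] and down at the other elements of [V]
    is at height at least [a] after the elements of [V] smaller than [t]. *)
Definition hit (n : nat) (V : {set 'I_n}) (a : nat) (A : {set 'I_n}) (t : nat) : bool :=
  #|below V t| + a <= 2 * #|A :&: below V t|.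

(** Times up to [n] suffice, because [below V t] is all of [V] from [t = n] on. *)
Definition hits (n : nat) (V : {set 'I_n}) (a : nat) (A : {set 'I_n}) : bool :=
  has (hit V a A) (iota 0 n.+1).

Definition first_hit (n : nat) (V : {set 'I_n}) (a : nat) (A : {set 'I_n}) : nat :=
  find (hit V a A) (iota 0 n.+1).

Lemma below_max (n : nat) (V : {set 'I_n}) (t : nat) : n <= t -> below V t = V.
Proof.
move=> nt; apply/setP=> i; rewrite inE (leq_trans (ltn_ord i) nt); exact: andbT.
Qed.

Lemma hit_hits (n : nat) (V : {set 'I_n}) (a : nat) (A : {set 'I_n}) (t : nat) :
  hit V a A t -> hits V a A.
Proof.
move=> h; apply/hasP; exists (minn t n); first by rewrite mem_iota; lia.
case: (leqP t n) => // nt; move: h.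
by rewrite /hit (below_max V (ltnW nt)) (below_max V (leqnn n)).
Qed.

Lemma first_hit_hit (n : nat) (V : {set 'I_n}) (a : nat) (A : {set 'I_n}) :
  hits V a A -> hit V a A (first_hit V a A).
Proof.
move=> h; have := nth_find 0 h; rewrite nth_iota ?add0n //.
by move: h; rewrite /hits has_find size_iota.
Qed.

Lemma first_hit_leq (n : nat) (V : {set 'I_n}) (a : nat) (A : {set 'I_n}) (t : nat) :
  hit V a A t -> first_hit V a A <= t.
Proof.
move=> h; rewrite leqNgt; apply/negP=> lt.
have := before_find 0 lt; rewrite nth_iota ?add0n ?h //.
have := find_size (hit V a A) (iota 0 n.+1); rewrite size_iota => le.
exact: leq_trans lt le.
Qed.

Lemma belowS (n : nat) (V : {set 'I_n}) (t : nat) (i : 'I_n) : val i = t ->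
  below V t.+1 = if i \in V then i |: below V t else below V t.
Proof.
move=> it; apply/setP=> j; case: ifP => iV; rewrite !inE ltnS leq_eqVlt -it.
  have -> : (val j == val i) = (j == i) by [].
  by case: eqP => [->|_] //=; rewrite iV.
have -> : (val j == val i) = (j == i) by [].
by case: eqP => [->|_] //=; rewrite iV.
Qed.

(** The walk starts at 0 and rises by at most 1 at a time, so it cannot jump over level [a]. *)
Lemma hit_first_eq (n : nat) (V : {set 'I_n}) (a : nat) (A : {set 'I_n}) :
  0 < a -> hits V a A ->
  2 * #|A :&: below V (first_hit V a A)| = #|below V (first_hit V a A)| + a.
Proof.
move=> a0 h; have := first_hit_hit h; have := @first_hit_leq n V a A.
case: (first_hit V a A) => [|t] fl.
  rewrite /hit; have -> : below V 0 = set0 by apply/setP=> i; rewrite !inE ltn0 andbF.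
  by rewrite setI0 cards0; lia.
have nt : ~~ hit V a A t by apply/negP=> /fl; lia.
case: (ltnP t n) => [tn|nt']; last first.
  by move: nt; rewrite /hit (below_max V nt') (below_max V (leqW nt')) => /negP.
move: nt; rewrite /hit (belowS V (erefl (val (Ordinal tn)))).
case: ifP => iV; last by move=> /negP.
have iB : Ordinal tn \notin below V t by rewrite inE /= ltnn andbF.
rewrite cardsU1 iB setIUr.
case: (boolP (Ordinal tn \in A)) => iA.
  have -> : A :&: [set Ordinal tn] = [set Ordinal tn].
    by apply/setIidPr; rewrite sub1set.
  by rewrite cardsU1 inE (negbTE iB) andbF /=; lia.
have -> : A :&: [set Ordinal tn] = set0.
  by apply/setP=> j; rewrite !inE; case: eqP => [->|]; rewrite ?(negbTE iA) ?andbF.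
by rewrite set0U /=; lia.
Qed.

(** Mirrors the walk up to time [t]. Elements outside [V] are dropped; they are recovered from the
    fixed trace [A :\: V]. *)
Definition flip (n : nat) (V : {set 'I_n}) (t : nat) (A : {set 'I_n}) : {set 'I_n} :=
  [set i in V | (i \in A) (+) (i < t)].

Lemma flipK (n : nat) (V : {set 'I_n}) (t : nat) (A : {set 'I_n}) :
  flip V t (flip V t A) = A :&: V.
Proof.
apply/setP=> i; rewrite !inE.
by case: (i \in V); case: (i \in A); case: (i < t).
Qed.

Lemma card_flip_below (n : nat) (V : {set 'I_n}) (s t : nat) (A : {set 'I_n}) :
  s <= t -> #|flip V t A :&: below V s| + #|A :&: below V s| = #|below V s|.
Proof.
move=> st; rewrite -[RHS](cardsID A) addnC [A :&: _]setIC; congr (_ + _).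
apply: eq_card => i; rewrite !inE.
case: (i \in V); rewrite ?andbF //=; case: (ltnP i s) => is_; rewrite ?andbF //.
by rewrite (leq_trans is_ st) addbT !andbT.
Qed.

Lemma card_flip (n : nat) (V : {set 'I_n}) (t : nat) (A : {set 'I_n}) :
  #|flip V t A| + 2 * #|A :&: below V t| = #|A :&: V| + #|below V t|.
Proof.
have := card_flip_below V A (leqnn t).
have := cardsID (below V t) (flip V t A); have := cardsID (below V t) (A :&: V).
have -> : A :&: V :&: below V t = A :&: below V t.
  by apply/setP=> i; rewrite !inE; case: (i \in V); rewrite ?andbF ?andbT.
suff -> : flip V t A :\: below V t = A :&: V :\: below V t by lia.
apply/setP=> i; rewrite !inE.
by case: (i \in V); case: (i \in A); case: (i < t).
Qed.

(** The reflection principle: flipping [A] on [V] up to its first visit of level [a]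
    lowers the cardinality by [a] and can be undone. *)
Lemma reflection (n : nat) (G : {set {set 'I_n}}) (V C : {set 'I_n}) (a k : nat) :
  0 < a ->
  (forall A, A \in G -> [/\ #|A| = k, A :\: V = C & hits V a A]) ->
  #|G| <= cb #|V| k (a + #|C|).
Proof.
(* Up to the first hit, the walk of [f A] is the mirror image of that of [A]: one is at or above [a]
   exactly when the other is at or below [-a]. Hence [f A] determines the time of the first hit. *)
move=> a0 hG; pose f A := flip V (first_hit V a A) A.
have level A s : A \in G -> s <= first_hit V a A ->
    hit V a A s = (2 * #|f A :&: below V s| + a <= #|below V s|).
  by move=> AG sA; have := card_flip_below V A sA; rewrite -/(f A) /hit => E; lia.
apply: (@card_leq_cb n G V f).
  have tle A B : A \in G -> B \in G -> f A = f B -> first_hit V a A <= first_hit V a B.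
    move=> AG BG fAB; rewrite leqNgt; apply/negP=> lt; have := lt; rewrite ltnNge.
    move/negP; apply; apply: first_hit_leq; rewrite level ?(ltnW lt) // fAB -level //.
    by case: (hG _ BG) => _ _ /first_hit_hit.
  move=> A B AG BG fAB.
  have tE : first_hit V a A = first_hit V a B.
    by apply/eqP; rewrite eqn_leq !tle.
  have VE : A :&: V = B :&: V.
    by rewrite -(flipK V (first_hit V a A)) -/(f A) fAB /f -tE flipK.
  have [_ AC _] := hG _ AG; have [_ BC _] := hG _ BG.
  by rewrite -(setID A V) -(setID B V) VE AC BC.
move=> A AG; have [Ak AC hA] := hG _ AG; split.
  by apply/subsetP=> i; rewrite inE => /andP[].
have := card_flip V (first_hit V a A) A; rewrite -/(f A) (hit_first_eq a0 hA).
by have := cardsID V A; rewrite AC Ak; lia.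
Qed.

(** * Counting members and shifting *)

(** A sum of booleans, so that inequalities between counts reduce to a case analysis on a single
    member. *)
Definition num (n : nat) (F : {set {set 'I_n}}) (P : pred {set 'I_n}) : nat :=
  \sum_(A in F) P A.

Lemma num_card (n : nat) (F : {set {set 'I_n}}) (P : pred {set 'I_n}) :
  num F P = #|[set A in F | P A]|.
Proof.
rewrite /num -big_mkcondr /= -sum1_card; apply: eq_bigl => A; by rewrite inE.
Qed.

Lemma eq_num (n : nat) (F : {set {set 'I_n}}) (P Q : pred {set 'I_n}) :
  {in F, P =1 Q} -> num F P = num F Q.
Proof. by move=> PQ; apply: eq_bigr => A /PQ ->. Qed.

Lemma num_exists (n : nat) (F : {set {set 'I_n}}) (P : pred {set 'I_n}) :
  0 < num F P -> exists2 A, A \in F & P A.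
Proof.
by rewrite num_card card_gt0 => /set0Pn[A]; rewrite inE => /andP[]; exists A.
Qed.

Definition swap (n : nat) (i j : 'I_n) (A : {set 'I_n}) : {set 'I_n} :=
  i |: (A :\ j).

Definition shift_set (n : nat) (F : {set {set 'I_n}}) (i j : 'I_n) (A : {set 'I_n}) :=
  if [&& j \in A, i \notin A & swap i j A \notin F] then swap i j A else A.

Definition shift (n : nat) (F : {set {set 'I_n}}) (i j : 'I_n) : {set {set 'I_n}} :=
  [set shift_set F i j A | A in F].

(** Stability is asked only inside [U], so that a chosen pair of vertices can be kept out of the
    shifting. *)
Definition shifted (n : nat) (U : {set 'I_n}) (F : {set {set 'I_n}}) : Prop :=
  forall (i j : 'I_n) (A : {set 'I_n}), i \in U -> j \in U -> i < j ->
    A \in F -> j \in A -> i \notin A -> swap i j A \in F.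

Definition swap_invariant (n : nat) (i j : 'I_n) (P : pred {set 'I_n}) : Prop :=
  forall A : {set 'I_n}, j \in A -> i \notin A -> P (swap i j A) = P A.

Lemma swapK (n : nat) (i j : 'I_n) (A : {set 'I_n}) :
  j \in A -> i \notin A -> swap j i (swap i j A) = A.
Proof.
move=> jA iA; apply/setP=> x; rewrite !inE.
case: (eqVneq x j) => [->|xj]; first by rewrite jA.
by case: (eqVneq x i) => [->|xi] /=; rewrite ?(negbTE iA).
Qed.

Lemma card_swap (n : nat) (i j : 'I_n) (A : {set 'I_n}) :
  j \in A -> i \notin A -> #|swap i j A| = #|A|.
Proof.
move=> jA iA; rewrite /swap cardsU1 !inE (negbTE iA) andbF /=.
by rewrite [RHS](cardsD1 j) jA.
Qed.

Lemma shift_set_inj (n : nat) (F : {set {set 'I_n}}) (i j : 'I_n) :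
  {in F &, injective (shift_set F i j)}.
Proof.
move=> A B AF BF; rewrite /shift_set.
case: ifP => [/and3P[jA iA sA]|_]; case: ifP => [/and3P[jB iB sB]|_] //.
- by move=> E; rewrite -(swapK jA iA) E swapK.
- by move=> E; rewrite E BF in sA.
- by move=> E; rewrite -E AF in sB.
Qed.

Lemma num_shift (n : nat) (F : {set {set 'I_n}}) (i j : 'I_n) (P : pred {set 'I_n}) :
  swap_invariant i j P -> num (shift F i j) P = num F P.
Proof.
move=> Pinv; rewrite /num /shift big_imset /=; last exact: shift_set_inj.
apply: eq_bigr => A _; rewrite /shift_set; case: ifP => // /and3P[jA iA _].
by rewrite Pinv.
Qed.

(** Every set newly created by the shift contains [i] and misses [j]. *)
Lemma mem_shift (n : nat) (F : {set {set 'I_n}}) (i j : 'I_n) A :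
  i != j -> A \in shift F i j -> (j \in A) || (i \notin A) -> A \in F.
Proof.
move=> ij /imsetP[B BF ->]; rewrite /shift_set; case: ifP => // _.
by rewrite !inE !eqxx /= ?andbF ?orbF eq_sym (negbTE ij).
Qed.

Lemma num_shift_leq (n : nat) (F : {set {set 'I_n}}) (i j : 'I_n) (P : pred {set 'I_n}) :
  i != j -> (forall A, P A -> (j \in A) || (i \notin A)) ->
  num (shift F i j) P <= num F P.
Proof.
move=> ij hP; rewrite !num_card; apply/subset_leq_card/subsetP=> A.
by rewrite !inE => /andP[/(mem_shift ij) AF PA]; rewrite PA AF ?hP.
Qed.

Lemma card_shift (n : nat) (F : {set {set 'I_n}}) (i j : 'I_n) :
  #|shift F i j| = #|F|.
Proof. by rewrite card_in_imset //; apply: shift_set_inj. Qed.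

Lemma uniform_shift (n k : nat) (F : {set {set 'I_n}}) (i j : 'I_n) :
  uniform k F -> uniform k (shift F i j).
Proof.
move=> Fk _ /imsetP[A AF ->]; rewrite /shift_set; case: ifP => [/and3P[jA iA _]|_].
  by rewrite card_swap ?Fk.
exact: Fk.
Qed.

Lemma intersecting_shift (n : nat) (F : {set {set 'I_n}}) (i j : 'I_n) :
  intersecting F -> intersecting (shift F i j).
Proof.
move=> Fi; have moved A B : A \in F -> B \in F -> j \in A -> i \notin A ->
    swap i j A \notin F -> swap i j A :&: shift_set F i j B != set0.
  move=> AF BF jA iA sA; apply/set0Pn; case: (boolP (i \in shift_set F i j B)) => iB.
    by exists i; rewrite !inE eqxx iB.
  move: iB; rewrite /shift_set; case: ifP => [_|nB iB]; first by rewrite !inE eqxx.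
  case: (boolP (j \in B)) => jB.
    (* [B] was left in place only because its swap is already present. [A] meets that swap in an
       element other than [i] and [j], which also lies in [B]. *)
    have sB : swap i j B \in F by move/negbT: nB; rewrite jB iB /= negbK.
    have /set0Pn[z] := Fi _ _ AF sB; rewrite !inE => /andP[zA].
    case/orP=> [/eqP zi|/andP[zj zB]]; first by rewrite -zi zA in iA.
    by exists z; rewrite !inE zj zA zB orbT.
  have /set0Pn[z] := Fi _ _ AF BF; rewrite !inE => /andP[zA zB].
  exists z; rewrite !inE zA zB andbT; case: (eqVneq z j) => [zj|_]; last exact: orbT.
  by rewrite -zj zB in jB.
move=> _ _ /imsetP[A AF ->] /imsetP[B BF ->].
case mA: [&& j \in A, i \notin A & swap i j A \notin F].
  rewrite {1}/shift_set mA; case/and3P: mA => *; exact: moved.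
case mB: [&& j \in B, i \notin B & swap i j B \notin F].
  rewrite setIC {1}/shift_set mB; case/and3P: mB => *; exact: moved.
by rewrite /shift_set mA mB; apply: Fi.
Qed.

(** The sum of all elements of all members drops with every shift that changes the family, so
    shifting terminates, and any property preserved on the way holds at the end. *)
Lemma shift_ind (n : nat) (U : {set 'I_n}) (P : {set {set 'I_n}} -> Prop) :
  (forall F (i j : 'I_n), i \in U -> j \in U -> i < j -> P F -> P (shift F i j)) ->
  forall F, P F -> exists2 F', P F' & shifted U F'.
Proof.
move=> step F; pose w (G : {set {set 'I_n}}) := \sum_(A in G) \sum_(a in A) (a : nat).
have [m] := ubnP (w F); elim: m F => // m IH F; rewrite ltnS => wm PF.
case: (boolP [forall i in U, forall j in U, forall A in F,
   [&& i < j, j \in A & i \notin A] ==> (swap i j A \in F)]) => [/forall_inP sF|].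
  exists F => // i j A iU jU ij AF jA iA; have /forall_inP/(_ _ jU) := sF i iU.
  by move/forall_inP/(_ _ AF); rewrite ij jA iA.
case/forall_inPn=> i iU /forall_inPn[j jU /forall_inPn[A AF]].
rewrite negb_imply => /andP[/and3P[ij jA iA] sA].
apply: (IH (shift F i j)); last exact: step.
have wswap (B : {set 'I_n}) : j \in B -> i \notin B ->
    \sum_(a in swap i j B) (a : nat) + j = \sum_(a in B) (a : nat) + i.
  move=> jB iB; rewrite big_setU1 /=; last by rewrite !inE (negbTE iB) andbF.
  by rewrite [in RHS](big_setD1 j) //= addnC [RHS]addnAC addnA.
apply: leq_trans wm; rewrite /w big_imset /=; last exact: shift_set_inj.
rewrite (bigD1 A) //= [X in _ < X](bigD1 A) //= -addSn leq_add //.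
  by rewrite /shift_set jA iA sA /= -(ltn_add2r j) wswap // ltn_add2l.
apply: leq_sum => B _; rewrite /shift_set; case: ifP => // /and3P[jB iB _].
by rewrite -(leq_add2r j) wswap // leq_add2l ltnW.
Qed.

(** * Walks of members of shifted families *)

(** The walk property of two members meeting only inside [U]: at the least common element
    [j] there would otherwise be a smaller [i] in [U] missed by both, and replacing [j]
    by [i] shrinks the intersection. *)
Lemma shifted_walk (n : nat) (U : {set 'I_n}) (F : {set {set 'I_n}}) (A B : {set 'I_n}) :
  shifted U F -> intersecting F -> A \in F -> B \in F -> A :&: B \subset U ->
  exists t, #|below U t| < #|A :&: below U t| + #|B :&: below U t|.
Proof.
move=> sF iF; have [m] := ubnP #|A :&: B|; elim: m A => // m IH A; rewrite ltnS => ABm.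
move=> AF BF ABU; have /set0Pn[j0 j0AB] := iF _ _ AF BF.
have [j jAB jmin] : exists2 j, j \in A :&: B & forall x, x \in A :&: B -> j <= x.
  by case: (arg_minnP (fun x : 'I_n => val x) j0AB) => j jAB jm; exists j.
have [jA jB] : j \in A /\ j \in B by apply/andP; rewrite -in_setI.
have jU : j \in U by apply: (subsetP ABU).
have disj t : t <= j -> [disjoint A :&: below U t & B :&: below U t].
  move=> tj; rewrite -setI_eq0; apply/eqP/setP=> x; rewrite !inE.
  apply/negP=> /andP[/andP[xA /andP[_ xt]] /andP[xB _]].
  by have := jmin x; rewrite inE xA xB leqNgt (leq_trans xt tj) => /(_ isT).
case: (ltnP #|below U j.+1| (#|A :&: below U j.+1| + #|B :&: below U j.+1|)) => [?|le].
  by exists j.+1.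
have [i] : exists i, (i \in below U j) && (i \notin A :|: B).
  apply/existsP; apply: contraT => /existsPn all.
  have cov : A :&: below U j :|: B :&: below U j = below U j.
    rewrite -setIUl; apply/setIidPr/subsetP=> x xb; have := all x.
    by rewrite xb /= negbK.
  have := (leq_card_setU (A :&: below U j) (B :&: below U j)).1; rewrite cov.
  move: le; rewrite (belowS U (erefl (val j))) jU !setIUr.
  have jb : j \notin below U j by rewrite inE ltnn andbF.
  have -> : A :&: [set j] = [set j] by apply/setIidPr; rewrite sub1set.
  have -> : B :&: [set j] = [set j] by apply/setIidPr; rewrite sub1set.
  by rewrite !cardsU1 !inE ltnn !andbF /=; clear; lia.
rewrite !inE negb_or => /andP[/andP[iU ij] /andP[iA iB]].
have sAB : swap i j A :&: B = (A :&: B) :\ j.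
  apply/setP=> x; rewrite !inE; case: (eqVneq x i) => [->|] /=; last by rewrite andbA.
  by rewrite (negbTE iB) !andbF.
have [t] : exists t,
    #|below U t| < #|swap i j A :&: below U t| + #|B :&: below U t|.
  apply: IH => //.
  - by rewrite sAB; move: ABm; rewrite (cardsD1 j (A :&: B)) jAB.
  - exact: sF.
  - by rewrite sAB; apply: subset_trans ABU; apply: subsetDl.
(* For [t <= j] the two sets are disjoint below [t], so the inequality is impossible. For [t > j]
   both [i] and [j] are counted, and the swap does not change the count. *)
case: (leqP t j) => tj lt.
  have : #|swap i j A :&: below U t| + #|B :&: below U t| <= #|below U t|; last by rewrite leqNgt lt.
  have d : [disjoint swap i j A :&: below U t & B :&: below U t].
    rewrite -setI_eq0 -subset0; apply/subsetP=> x.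
    have := disj _ tj; rewrite -setI_eq0 => /eqP/setP/(_ x); rewrite !inE.
    case: (eqVneq x i) => [->|_] /=; first by rewrite (negbTE iB) !andbF.
    case: (x \in A) => //=; last by rewrite andbF.
    by case: (x \in U) => //; case: (x < t) => //; case: (x \in B); rewrite ?andbF.
  move: d; rewrite -(leq_card_setU _ _).2 => /eqP <-.
  by apply: subset_leq_card; rewrite -setIUl subsetIr.
exists t; apply: leq_trans lt _; rewrite leq_add2r.
have -> : swap i j A :&: below U t = swap i j (A :&: below U t).
  apply/setP=> x; rewrite !inE; case: (eqVneq x i) => [->|] /=; last by rewrite !andbA.
  by rewrite iU (ltn_trans ij tj).
by rewrite card_swap // !inE ?jA ?jU ?tj // (negbTE iA).
Qed.

Lemma first_elements (n : nat) (U : {set 'I_n}) (s : nat) : s <= #|U| ->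
  exists W : {set 'I_n}, [/\ W \subset U, #|W| = s &
    forall w v, w \in W -> v \in U :\: W -> w < v].
Proof.
elim: s => [|s IH] sU.
  by exists set0; split=> [||w v]; rewrite ?sub0set ?cards0 ?inE.
have [W [WU Ws Wlt]] := IH (ltnW sU).
have /set0Pn[z zUW] : U :\: W != set0 by rewrite -card_gt0 cardsDS // Ws; lia.
have [m mUW mmin] : exists2 m, m \in U :\: W & forall x, x \in U :\: W -> m <= x.
  by case: (arg_minnP (fun x : 'I_n => val x) zUW) => m mUW mm; exists m.
move: (mUW); rewrite inE => /andP[mW mU].
exists (m |: W); split.
- by rewrite subUset sub1set mU.
- by rewrite cardsU1 mW Ws.
move=> w v wW; rewrite !inE negb_or -andbA => /and3P[vm vW vU].
have vUW : v \in U :\: W by rewrite inE vW.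
move: wW; rewrite !inE => /orP[/eqP ->|wW]; last exact: Wlt.
have := mmin _ vUW; rewrite leq_eqVlt => /orP[/eqP/val_inj E|//].
by rewrite E eqxx in vm.
Qed.

(** Since [A] starts with [#|W|] down steps and then rises by at most 1, it lies so low
    that the walk property pushes [B] up to height [#|W| + 1]. *)
Lemma avoiding_hits (n : nat) (U W : {set 'I_n}) (F : {set {set 'I_n}}) (A B : {set 'I_n}) :
  shifted U F -> intersecting F -> W \subset U ->
  (forall w v, w \in W -> v \in U :\: W -> w < v) ->
  A \in F -> B \in F -> A :&: B \subset U -> [disjoint A & W] ->
  ~~ hits (U :\: W) 2 A -> hits U #|W|.+1 B.
Proof.
move=> sF iF WU Wlt AF BF ABU AW nh.
have [t tlt] := shifted_walk sF iF AF BF ABU; apply: (@hit_hits _ _ _ _ t).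
have AE : A :&: below U t = A :&: below (U :\: W) t.
  apply/setP=> x; rewrite !inE; case: (boolP (x \in A)) => //= xA.
  by rewrite (disjointFr AW xA).
have nht : ~~ hit (U :\: W) 2 A t by apply: contra nh => /hit_hits.
have Ble : #|B :&: below U t| <= #|below U t| by apply: subset_leq_card; apply: subsetIr.
(* If nothing of [U :\: W] lies below [t], then [A] contributes nothing and the walk property fails.
   Otherwise [t] exceeds all of [W], and its down steps count in full. *)
case: (set_0Vmem (below (U :\: W) t)) => [E|[v]].
  by move: tlt; rewrite AE E setI0 cards0; lia.
rewrite inE => /andP[vUW vt].
have UE : #|below U t| = #|below (U :\: W) t| + #|W|.
  rewrite -(cardsID W (below U t)) addnC; congr (_ + _).
    by apply: eq_card => x; rewrite !inE andbA.
  apply: eq_card => x; rewrite !inE; apply/andP/idP => [[]//|xW].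
  by rewrite (subsetP WU) // (ltn_trans _ vt) // Wlt.
move: nht tlt; rewrite /hit AE UE; lia.
Qed.

(** When [U] is the complement of a pair, the four possible traces [C] give the four cells [both],
    [only] (twice) and [neither]. *)
Definition trace_num (n : nat) (F : {set {set 'I_n}}) (U C : {set 'I_n}) : nat :=
  num F (fun A => A :\: U == C).

Lemma trace_num_hits (n k a : nat) (F : {set {set 'I_n}}) (U C : {set 'I_n}) :
  0 < a -> uniform k F -> (forall A, A \in F -> A :\: U = C -> hits U a A) ->
  trace_num F U C <= cb #|U| k (a + #|C|).
Proof.
move=> a0 Fk hF; rewrite /trace_num num_card; apply: reflection => // A.
by rewrite inE => /andP[AF /eqP AC]; split; [exact: Fk| |exact: hF].
Qed.

(** Union bound: with trace [C], at most [#|W| * m] members meet [W], and by reflection few of the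
    others have a walk on [U :\: W] reaching level 2. *)
Lemma exists_avoiding (n k m : nat) (F : {set {set 'I_n}}) (U W C : {set 'I_n}) :
  uniform k F -> W \subset U ->
  (forall w, w \in W -> num F (fun A => (A :\: U == C) && (w \in A)) <= m) ->
  #|W| * m + cb (#|U| - #|W|) k (2 + #|C|) < trace_num F U C ->
  exists2 A, A \in F & [/\ A :\: U = C, [disjoint A & W] & ~~ hits (U :\: W) 2 A].
Proof.
move=> Fk WU hm lt.
pose P A := [&& A :\: U == C, [disjoint A & W] & ~~ hits (U :\: W) 2 A].
suff /num_exists[A AF /and3P[/eqP ? ? ?]] : 0 < num F P by exists A.
pose Q A := [&& A :\: U == C, [disjoint A & W] & hits (U :\: W) 2 A].
have Qle : num F Q <= cb (#|U| - #|W|) k (2 + #|C|).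
  rewrite num_card -(cardsDS WU); apply: reflection => // A.
  rewrite inE => /and4P[AF /eqP AC AW hA]; split=> //; first exact: Fk.
  rewrite -AC; apply/setP=> x; rewrite !inE; case: (boolP (x \in A)) => xA; last by rewrite !andbF.
  by rewrite (disjointFr AW xA).
have Wle : \sum_(w in W) num F (fun A => (A :\: U == C) && (w \in A)) <= #|W| * m.
  by rewrite -sum_nat_const; apply: leq_sum.
have : trace_num F U C <=
    \sum_(w in W) num F (fun A => (A :\: U == C) && (w \in A)) + num F Q + num F P.
  rewrite /trace_num /num exchange_big -!big_split; apply: leq_sum => A AF /=.
  rewrite /Q /P; case: (A :\: U == C) => //=.
  case: (boolP [disjoint A & W]) => [_|]; first by case: hits => /=; lia.
  rewrite -setI_eq0 => /set0Pn[w]; rewrite inE => /andP[wA wW].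
  by rewrite (bigD1 w) //= wA.
lia.
Qed.

(** Take for [W] the [s] smallest elements of [U]. One low member with trace [C] forces every member
    with trace [D] up to level [s + 1], and reflection counts the latter. Disjoint traces keep the
    intersections inside [U]. *)
Lemma trace_num_dichotomy (n k m s : nat) (F : {set {set 'I_n}}) (U C D : {set 'I_n}) :
  uniform k F -> intersecting F -> shifted U F -> s <= #|U| ->
  [disjoint C & D] ->
  (forall w, w \in U -> num F (fun A => (A :\: U == C) && (w \in A)) <= m) ->
  s * m + cb (#|U| - s) k (2 + #|C|) < trace_num F U C ->
  trace_num F U D <= cb #|U| k (s.+1 + #|D|).
Proof.
move=> Fk iF sF sU CD hm lt.
have [W [WU Ws Wlt]] := first_elements sU.
have [||A AF [AC AW nh]] := exists_avoiding (m := m) (C := C) Fk WU.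
- by move=> w wW; apply: hm; apply: (subsetP WU).
- by rewrite Ws.
apply: trace_num_hits => // B BF BD; rewrite -Ws.
apply: (avoiding_hits sF iF WU Wlt AF BF) => //.
apply/subsetP=> x; rewrite inE => /andP[xA xB]; apply: contraT => xU.
have xC : x \in C by rewrite -AC inE xU.
have : x \in D by rewrite -BD inE xU.
by rewrite (disjointFr CD xC).
Qed.

(** * The four cells of a pair of vertices *)

Definition both (n : nat) (F : {set {set 'I_n}}) (x y : 'I_n) : nat :=
  num F (fun A => (x \in A) && (y \in A)).
Definition only (n : nat) (F : {set {set 'I_n}}) (x y : 'I_n) : nat :=
  num F (fun A => (x \in A) && (y \notin A)).
Definition neither (n : nat) (F : {set {set 'I_n}}) (x y : 'I_n) : nat :=
  num F (fun A => (x \notin A) && (y \notin A)).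
Definition avoid (n : nat) (F : {set {set 'I_n}}) (x : 'I_n) : nat :=
  num F (fun A => x \notin A).

Lemma bothC (n : nat) (F : {set {set 'I_n}}) (x y : 'I_n) : both F x y = both F y x.
Proof. by apply: eq_num => A _; rewrite andbC. Qed.

Lemma neitherC (n : nat) (F : {set {set 'I_n}}) (x y : 'I_n) : neither F x y = neither F y x.
Proof. by apply: eq_num => A _; rewrite andbC. Qed.

Lemma avoidE (n : nat) (F : {set {set 'I_n}}) (x y : 'I_n) :
  avoid F x = only F y x + neither F x y.
Proof.
rewrite /avoid /only /neither /num -big_split; apply: eq_bigr => A _ /=.
by case: (x \in A); case: (y \in A).
Qed.

Lemma card_cells (n : nat) (F : {set {set 'I_n}}) (x y : 'I_n) :
  #|F| = both F x y + only F x y + only F y x + neither F x y.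
Proof.
rewrite -sum1_card /both /only /neither /num -!big_split; apply: eq_bigr => A _ /=.
by case: (x \in A); case: (y \in A).
Qed.

Lemma setD_pair (n : nat) (x y : 'I_n) (A : {set 'I_n}) :
  A :\: ~: [set x; y] = A :&: [set x; y].
Proof. by rewrite setDE setCK. Qed.

Lemma trace_eq (n : nat) (x y : 'I_n) (A C : {set 'I_n}) : C \subset [set x; y] ->
  (A :\: ~: [set x; y] == C) = ((x \in A) == (x \in C)) && ((y \in A) == (y \in C)).
Proof.
move=> CS; rewrite setD_pair; apply/eqP/andP => [<-|[/eqP xE /eqP yE]].
  by rewrite !inE !eqxx ?orbT !andbT.
apply/setP=> z; rewrite !inE.
case: (eqVneq z x) => [->|zx]; first by rewrite andbT.
case: (eqVneq z y) => [->|zy]; first by rewrite andbT.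
by rewrite andbF; apply/esym/negP => /(subsetP CS); rewrite !inE (negbTE zx) (negbTE zy).
Qed.

Lemma both_trace (n : nat) (F : {set {set 'I_n}}) (x y : 'I_n) :
  both F x y = trace_num F (~: [set x; y]) [set x; y].
Proof.
apply: eq_num => A _; rewrite trace_eq // !inE !eqxx orbT.
by case: (x \in A); case: (y \in A).
Qed.

Lemma only_trace (n : nat) (F : {set {set 'I_n}}) (x y : 'I_n) : x != y ->
  only F x y = trace_num F (~: [set x; y]) [set x].
Proof.
move=> xy; apply: eq_num => A _; rewrite trace_eq ?sub1set ?inE ?eqxx //.
by rewrite [y == x]eq_sym (negbTE xy); case: (x \in A); case: (y \in A).
Qed.

Lemma neither_trace (n : nat) (F : {set {set 'I_n}}) (x y : 'I_n) :
  neither F x y = trace_num F (~: [set x; y]) set0.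
Proof.
apply: eq_num => A _; rewrite trace_eq ?sub0set // !inE.
by case: (x \in A); case: (y \in A).
Qed.

Lemma mem_swap (n : nat) (i j x : 'I_n) (A : {set 'I_n}) :
  x != i -> x != j -> (x \in swap i j A) = (x \in A).
Proof. by move=> xi xj; rewrite !inE (negbTE xi) xj. Qed.

Lemma swap_invariant_pair (n : nat) (i j x y : 'I_n) (P : bool -> bool -> bool) :
  i \in ~: [set x; y] -> j \in ~: [set x; y] ->
  swap_invariant i j (fun A => P (x \in A) (y \in A)).
Proof.
rewrite !inE !negb_or => /andP[ix iy] /andP[jx jy] A _ _ /=.
by rewrite !mem_swap // eq_sym.
Qed.

Lemma cells_shift (n : nat) (F : {set {set 'I_n}}) (i j x y : 'I_n) :
  i \in ~: [set x; y] -> j \in ~: [set x; y] ->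
  [/\ both (shift F i j) x y = both F x y, only (shift F i j) x y = only F x y,
      only (shift F i j) y x = only F y x & neither (shift F i j) x y = neither F x y].
Proof.
move=> iU jU; split; apply: num_shift.
- exact: (@swap_invariant_pair _ _ _ _ _ (fun a b => a && b)).
- exact: (@swap_invariant_pair _ _ _ _ _ (fun a b => a && ~~ b)).
- exact: (@swap_invariant_pair _ _ _ _ _ (fun a b => b && ~~ a)).
- exact: (@swap_invariant_pair _ _ _ _ _ (fun a b => ~~ a && ~~ b)).
Qed.

Lemma card_setC_pair (n : nat) (x y : 'I_n) : x != y -> #|~: [set x; y]| = n - 2.
Proof. by move=> xy; rewrite cardsCs setCK card_ord cards2 xy. Qed.

Lemma num_triple (n k : nat) (F : {set {set 'I_n}}) (x y z : 'I_n) :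
  uniform k F -> x != y -> x != z -> y != z ->
  num F (fun A => [&& x \in A, y \in A & z \in A]) <= cb (n - 3) k 3.
Proof.
move=> Fk xy xz yz; rewrite num_card.
have S3 : #|[set x; y; z]| = 3.
  by rewrite -setUA cardsU1 cards2 yz !inE negb_or xy xz.
have -> : n - 3 = #|~: [set x; y; z]| by rewrite cardsCs setCK card_ord S3.
have sub A : A \in [set A in F | [&& x \in A, y \in A & z \in A]] -> [set x; y; z] \subset A.
  by rewrite inE => /and4P[_ xA yA zA]; rewrite !subUset !sub1set xA yA zA.
apply: (@card_leq_cb _ _ _ (fun A => A :\: [set x; y; z])).
  move=> A B /sub sA /sub sB /= E.
  by rewrite -(setID A [set x; y; z]) -(setID B [set x; y; z]) E (setIidPr sA) (setIidPr sB).
move=> A AG; split; first by rewrite setDE subsetIr.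
rewrite cardsDS ?sub // S3.
have := subset_leq_card (sub _ AG); rewrite S3.
by move: AG; rewrite inE => /andP[/Fk -> _]; lia.
Qed.

(** * Heavy pairs and heavy triangles *)

(** The dichotomy with traces [[set x; y]] and [set0] and [s = 3]: the three vertices cost at most
    [3u] by [num_triple] and the high walks at most [u], whence the threshold [4u]. *)
Lemma neither_of_heavy (n k : nat) (F : {set {set 'I_n}}) (x y : 'I_n) :
  0 < k -> 24 * k <= n -> uniform k F -> intersecting F -> x != y ->
  4 * cb (n - 3) k 3 < both F x y -> neither F x y <= cb (n - 2) k 4.
Proof.
move=> k0 nk Fk iF xy hb.
pose P G := [/\ uniform k G, intersecting G, both G x y = both F x y &
                neither G x y = neither F x y].
have [||G [Gk iG bG nG] sG] := @shift_ind n (~: [set x; y]) P _ F.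
- move=> G i j iU jU ij [Gk iG bG nG]; have [bE _ _ nE] := cells_shift G iU jU.
  split; rewrite ?bE ?nE //; first exact: uniform_shift.
  exact: intersecting_shift.
- by split.
rewrite -nG neither_trace.
have := @trace_num_dichotomy n k (cb (n - 3) k 3) 3 G (~: [set x; y]) [set x; y] set0.
rewrite card_setC_pair // cards0 addn0; apply=> //.
- by lia.
- by rewrite disjoint_sym disjoints_subset sub0set.
- move=> w; rewrite !inE negb_or => /andP[wx wy].
  apply: leq_trans (num_triple Gk xy _ _); first last.
  + by rewrite eq_sym; exact: wy.
  + by rewrite eq_sym; exact: wx.
  by apply: leq_sum => A _; rewrite trace_eq // !inE !eqxx orbT !eqb_id andbA.
rewrite -both_trace bG cards2 xy.
have := cb_n2k4_leq k0 nk; have := @cb_leq (n - 2 - 3) (n - 2) k 4.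
rewrite leq_subr => /(_ isT); set a := cb _ _ _; set b := cb _ _ _; set c := cb _ _ _. lia.
Qed.

(** The dichotomy with trace [[set x]] and [s = 2]: two light pairs cost [8u] and the high walks at
    most [u]. The opposite trace is [[set y]] or empty. *)
Lemma only_dichotomy (n k : nat) (F : {set {set 'I_n}}) (x y : 'I_n) :
  0 < k -> 24 * k <= n -> uniform k F -> intersecting F -> x != y ->
  shifted (~: [set x; y]) F ->
  (forall v, v != x -> v != y -> both F x v <= 4 * cb (n - 3) k 3) ->
  9 * cb (n - 3) k 3 < only F x y ->
  only F y x <= cb (n - 2) k 4 /\ neither F x y <= cb (n - 2) k 3.
Proof.
move=> k0 nk Fk iF xy sF hx lt.
have trace_le (D : {set 'I_n}) : [disjoint [set x] & D] ->
    trace_num F (~: [set x; y]) D <= cb (n - 2) k (3 + #|D|).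
  move=> xD; rewrite -(card_setC_pair xy).
  apply: (@trace_num_dichotomy n k (4 * cb (n - 3) k 3) 2 F _ [set x]) => //.
  - by rewrite card_setC_pair //; lia.
  - move=> w; rewrite !inE negb_or => /andP[wx wy].
    apply: leq_trans (hx w wx wy); apply: leq_sum => A _.
    rewrite trace_eq ?sub1set ?inE ?eqxx // eqb_id.
    by case: (x \in A); case: (w \in A); rewrite ?andbF ?leq_b1.
  rewrite card_setC_pair // cards1 -only_trace //.
  have := @cb_leq (n - 2 - 2) (n - 3) k 3.
  have -> : n - 2 - 2 <= n - 3 by lia.
  by move=> /(_ isT); set a := cb _ _ _; set b := cb _ _ _; lia.
split; last by rewrite neither_trace; have := trace_le set0; rewrite cards0 addn0; apply;
  rewrite disjoint_sym disjoints_subset sub0set.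
rewrite only_trace 1?eq_sym // [[set y; x]]setUC.
have := trace_le [set y]; rewrite cards1; apply.
by rewrite disjoints_subset sub1set !inE.
Qed.

Lemma only_leq (n : nat) (F : {set {set 'I_n}}) (x y v : 'I_n) :
  only F y x <= both F y v + neither F x v.
Proof.
rewrite /only /both /neither /num -big_split; apply: leq_sum => A _ /=.
by case: (x \in A); case: (y \in A); case: (v \in A).
Qed.

Lemma both_shift_leq (n : nat) (F : {set {set 'I_n}}) (i j x y : 'I_n) :
  i != j -> x != i -> y != i -> both (shift F i j) x y <= both F x y.
Proof.
move=> ij xi yi; case: (eqVneq x j) => [xj|xj].
  by apply: num_shift_leq => // A /andP[xA _]; rewrite -xj xA.
case: (eqVneq y j) => [yj|yj].
  by apply: num_shift_leq => // A /andP[_ yA]; rewrite -yj yA.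
by rewrite /both num_shift // => A _ _; rewrite !mem_swap.
Qed.

(** Containing [x] and at least one of [i], [j] is invariant under the swap. *)
Lemma both_shift_leq2 (n : nat) (F : {set {set 'I_n}}) (i j x : 'I_n) :
  x != i -> x != j -> both (shift F i j) x i <= both F x i + both F x j.
Proof.
move=> xi xj; pose P (A : {set 'I_n}) := (x \in A) && ((i \in A) || (j \in A)).
apply: (@leq_trans (num (shift F i j) P)).
  by apply: leq_sum => A _; rewrite /P; case: (x \in A); case: (i \in A).
rewrite num_shift => [|A jA iA]; last first.
  by rewrite /P mem_swap // !inE eqxx jA orbT.
rewrite /both /num -big_split; apply: leq_sum => A _; rewrite /P /=.
by case: (x \in A); case: (i \in A); case: (j \in A).
Qed.

Lemma heavy_neighbour (n k : nat) (F : {set {set 'I_n}}) (x y : 'I_n) :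
  0 < k -> 24 * k <= n -> uniform k F -> intersecting F ->
  (forall v, 12 * cb (n - 3) k 3 < avoid F v) ->
  x != y -> 4 * cb (n - 3) k 3 < both F x y ->
  exists v, [&& v != x, v != y &
    (4 * cb (n - 3) k 3 < both F x v) || (4 * cb (n - 3) k 3 < both F y v)].
Proof.
set u := cb (n - 3) k 3 => k0 nk Fk iF div xy hxy.
apply/existsP; apply: contraT => /existsPn light.
have Tu : cb (n - 2) k 4 <= u := cb_n2k4_leq k0 nk.
have nxy : neither F x y <= u := leq_trans (neither_of_heavy k0 nk Fk iF xy hxy) Tu.
have oyx : 11 * u < only F y x by have := div x; rewrite (avoidE F x y); lia.
have oxy : 11 * u < only F x y.
  by have := div y; rewrite (avoidE F y x) neitherC; lia.
pose P G := [/\ uniform k G, intersecting G, only G x y = only F x y,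
  only G y x = only F y x &
  forall v, v != x -> v != y -> both G x v <= 4 * u /\ both G y v <= 4 * u].
(* Were [a], [i] heavy, at most [u] members would avoid both; then [only G b a] would be at most
   [8u + u], contrary to [11u]. *)
have step1 (a b : 'I_n) G (i : 'I_n) : uniform k G -> intersecting G -> 11 * u < only G b a ->
    i != a -> both G a i <= 8 * u -> both G b i <= 8 * u -> both G a i <= 4 * u.
  move=> Gk iG oba ia ha hb; rewrite leqNgt; apply/negP=> hai.
  have ai : a != i by rewrite eq_sym.
  have := neither_of_heavy k0 nk Gk iG ai hai; have := only_leq G a b i; lia.
have [||G [Gk iG xG yG lG] sG] := @shift_ind n (~: [set x; y]) P _ F.
- move=> G i j iU jU ij [Gk iG xG yG lG].
  have [bE xE yE nE] := cells_shift G iU jU.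
  have G'k : uniform k (shift G i j) by apply: uniform_shift.
  have iG' : intersecting (shift G i j) by apply: intersecting_shift.
  have nij : i != j by rewrite neq_ltn ij.
  split=> //; rewrite ?xE ?yE // => v vx vy.
  move: iU jU; rewrite !inE !negb_or => /andP[ix iy] /andP[jx jy].
  have [xi yi xj yj] : [/\ x != i, y != i, x != j & y != j].
    by rewrite ![x == _]eq_sym ![y == _]eq_sym.
  case: (eqVneq v i) => [->|vi]; last first.
    by have [lx ly] := lG v vx vy; split; [apply: leq_trans lx|apply: leq_trans ly];
      exact: both_shift_leq.
  have [lxi lyi] := lG i ix iy; have [lxj lyj] := lG j jx jy.
  have le8 (a : 'I_n) : a != i -> a != j -> both G a i <= 4 * u -> both G a j <= 4 * u ->
      both (shift G i j) a i <= 8 * u.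
    by move=> ai aj hi hj; rewrite (leq_trans (both_shift_leq2 G ai aj)) // (leq_trans (leq_add hi hj)) //
      -mulnDl.
  have bx := le8 x xi xj lxi lxj; have b_y := le8 y yi yj lyi lyj.
  split; first by apply: (@step1 x y) => //; rewrite yE yG.
  by apply: (@step1 y x) => //; rewrite xE xG.
- split=> // v vx vy; have := light v.
  by rewrite vx vy negb_or -!leqNgt => /andP.
(* Since [only G x y] exceeds [9u], the opposite cell has at most [u] members, but it has more than
   [11u]. *)
have [||oG _] := only_dichotomy k0 nk Gk iG xy sG.
- by move=> v vx vy; have [] := lG v vx vy.
- by rewrite xG -/u; lia.
by move: oG; rewrite yG; lia.
Qed.

Lemma heavy_triangle (n k : nat) (F : {set {set 'I_n}}) (x y : 'I_n) :
  0 < k -> 24 * k <= n -> uniform k F -> intersecting F ->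
  (forall v, 12 * cb (n - 3) k 3 < avoid F v) ->
  x != y -> 4 * cb (n - 3) k 3 < both F x y ->
  exists v, [/\ v != x, v != y, 4 * cb (n - 3) k 3 < both F x v &
    4 * cb (n - 3) k 3 < both F y v].
Proof.
move=> k0 nk Fk iF div xy hxy.
have Tu := cb_n2k4_leq k0 nk.
(* More than [12u] members avoid [a]; at most [u] of them avoid [b] and at most [u] avoid [v], so
   more than [10u] contain both [b] and [v]. *)
have third (a b v : 'I_n) : a != b -> v != a -> 4 * cb (n - 3) k 3 < both F a b ->
    4 * cb (n - 3) k 3 < both F a v -> 4 * cb (n - 3) k 3 < both F b v.
  move=> ab va hab hav; have av : a != v by rewrite eq_sym.
  have := neither_of_heavy k0 nk Fk iF ab hab.
  have := neither_of_heavy k0 nk Fk iF av hav.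
  by have := div a; rewrite (avoidE F a b); have := only_leq F a b v; lia.
have [v /and3P[vx vy /orP[hv|hv]]] := heavy_neighbour k0 nk Fk iF div xy hxy.
  by exists v; split=> //; apply: (third x).
by exists v; split=> //; apply: (third y) => //; rewrite 1?eq_sym 1?bothC.
Qed.

(** * Fully shifted families *)

Lemma card_below_geq (n c t : nat) :
  #|below [set i : 'I_n | c <= i] t| = minn t n - c.
Proof.
elim: t => [|t IH].
  by rewrite min0n; apply/eqP; rewrite cards_eq0; apply/eqP/setP=> i; rewrite !inE andbF.
case: (ltnP t n) => [tn|nt]; last first.
  by move: IH; rewrite !below_max ?(leqW nt) // => ->; lia.
rewrite (belowS _ (erefl (val (Ordinal tn)))) inE /=.
case: (leqP c t) => ct; last by rewrite IH; lia.
by rewrite cardsU1 IH inE /= ltnn andbF /=; lia.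
Qed.

Lemma card_geq (n c : nat) : #|[set i : 'I_n | c <= i]| = n - c.
Proof. by have := card_below_geq n c n; rewrite below_max ?minnn. Qed.

(** Every walk gets above 0. Members missing vertex 0 contain 1 and 2 (at most [4u]), or miss 1 and
    then climb to level 3 (at most [2u]), or contain 1, miss 2 and then climb to level 2 (at most
    [u]). *)
Lemma shifted_full (n k : nat) (F : {set {set 'I_n}}) :
  0 < k -> 24 * k <= n -> uniform k F -> intersecting F -> shifted setT F ->
  (forall x y, x != y -> both F x y <= 4 * cb (n - 3) k 3) ->
  exists v, avoid F v <= 7 * cb (n - 3) k 3.
Proof.
move=> k0 nk Fk iF sF light.
have [n0 n1 n2] : [/\ 0 < n, 1 < n & 2 < n] by split; lia.
pose V c := [set i : 'I_n | c <= i].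
have walk (A : {set 'I_n}) : A \in F -> exists m t, [/\ #|below (V 1) t| = m - 1,
    #|below (V 2) t| = m - 2, #|below (V 3) t| = m - 3 & m < 2 * #|A :&: below (V 0) t|].
  move=> AF; have [t] := shifted_walk sF iF AF AF (subsetT _).
  have -> : [set: 'I_n] = V 0 by apply/setP=> i; rewrite !inE.
  rewrite !card_below_geq => lt; exists (minn t n), t; split; rewrite ?card_below_geq //.
  by move: lt; rewrite subn0 addnn mul2n.
exists (Ordinal n0).
have le2 : trace_num F (V 2) set0 <= 2 * cb (n - 3) k 3.
  apply: leq_trans (cb_n2k3 nk); rewrite -(card_geq n 2).
  have := @trace_num_hits n k 3 F (V 2) set0; rewrite cards0 addn0; apply=> //.
  move=> A AF /eqP; rewrite setD_eq0 => AV.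
  have [m [t [_ E2 _ lt]]] := walk _ AF; apply: (@hit_hits _ _ _ _ t).
  have E : A :&: below (V 0) t = A :&: below (V 2) t.
    apply/setP=> i; rewrite !inE; case: (boolP (i \in A)) => //= /(subsetP AV).
    by rewrite inE => ->.
  have := subset_leq_card (subsetIr A (below (V 2) t)).
  by move: lt; rewrite /hit E E2; lia.
have le3 : trace_num F (V 3) [set Ordinal n1] <= cb (n - 3) k 3.
  rewrite -(card_geq n 3).
  have := @trace_num_hits n k 2 F (V 3) [set Ordinal n1]; rewrite cards1; apply=> //.
  move=> A AF AV; have [m [t [E1 _ E3 lt]]] := walk _ AF; apply: (@hit_hits _ _ _ _ t).
  have mem (i : 'I_n) : i \in A -> i < 3 -> i = Ordinal n1.
    by move=> iA i3; apply/set1P; rewrite -AV !inE iA -ltnNge i3.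
  (* As 0 is missing, this bound forces [m >= 3], so that the truncated [m - 3] is exact. *)
  have b1 : #|A :&: below (V 0) t| <= #|below (V 1) t|.
    apply/subset_leq_card/subsetP=> i; rewrite !inE => /andP[iA /andP[_ it]]; rewrite it andbT lt0n.
    apply/negP=> /eqP i0; have i3 : i < 3 by rewrite i0.
    by move: i0; rewrite (mem i iA i3).
  have b3 : #|A :&: below (V 0) t| <= 1 + #|A :&: below (V 3) t|.
    rewrite -[X in X + _](cards1 (Ordinal n1)); apply: leq_trans (leq_card_setU _ _).1.
    apply/subset_leq_card/subsetP=> i; rewrite !inE => /andP[iA /andP[_ it]]; rewrite iA it andbT.
    by case: (ltnP i 3) => [i3|_]; [rewrite (mem i iA i3) eqxx|rewrite orbT].
  have := subset_leq_card (subsetIr A (below (V 3) t)).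
  by move: lt b1; rewrite /hit E1 E3; lia.
have : avoid F (Ordinal n0) <=
    both F (Ordinal n1) (Ordinal n2) + trace_num F (V 2) set0 + trace_num F (V 3) [set Ordinal n1].
  rewrite /avoid /both /trace_num /num -!big_split; apply: leq_sum => A _ /=.
  case: (boolP (Ordinal n0 \in A)) => //= A0.
  case: (boolP (Ordinal n1 \in A)) => /= A1; last first.
    have -> : A :\: V 2 == set0; last by lia.
    rewrite setD_eq0; apply/subsetP=> i iA; rewrite inE ltnNge.
    apply/negP; rewrite leq_eqVlt ltnS leqn0 => /orP[] /eqP i0.
      by case/negP: A1; have <- : i = Ordinal n1 by apply: val_inj.
    by case/negP: A0; have <- : i = Ordinal n0 by apply: val_inj.
  case: (boolP (Ordinal n2 \in A)) => //= A2.
  have -> : A :\: V 3 == [set Ordinal n1]; last by lia.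
  apply/eqP/setP=> i; rewrite !inE -ltnNge.
  apply/andP/eqP => [[i3 iA]|-> //]; apply/val_inj => /=.
  case: i i3 iA => [[|[|[|i]]] //= ilt] _ iA.
    by case/negP: A0; move: iA; congr (_ \in A); apply: val_inj.
  by case/negP: A2; move: iA; congr (_ \in A); apply: val_inj.
have := light (Ordinal n1) (Ordinal n2) isT; lia.
Qed.

(** * Existence of a heavy pair *)

Lemma heavy_pair (n k : nat) (F : {set {set 'I_n}}) :
  0 < k -> 24 * k <= n -> uniform k F -> intersecting F -> F != set0 ->
  48 * cb (n - 3) k 3 <= #|F| ->
  (forall v, 12 * cb (n - 3) k 3 < avoid F v) ->
  exists x y, x != y /\ 4 * cb (n - 3) k 3 < both F x y.
Proof.
set u := cb (n - 3) k 3 => k0 nk Fk iF F0 hF div.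
suff /existsP[x /existsP[y /andP[xy hxy]]] :
  [exists x, exists y, (x != y) && (4 * u < both F x y)] by exists x, y.
apply: contraT => /existsPn nh.
have Tu : cb (n - 2) k 4 <= u := cb_n2k4_leq k0 nk.
have T3u : cb (n - 2) k 3 <= 2 * u := cb_n2k3 nk.
have Fpos : 0 < #|F| by rewrite card_gt0.
pose inv (G : {set {set 'I_n}}) := [/\ uniform k G, intersecting G, #|G| = #|F|,
  forall v, 12 * u < avoid G v & forall x y, x != y -> both G x y <= 4 * u].
have invF : inv F.
  split=> // x y xy; rewrite leqNgt; apply: contra (nh x) => hxy.
  by apply/existsP; exists y; rewrite xy.
have inv_shift G (i j : 'I_n) : i != j -> inv G -> 12 * u < neither G i j ->
    inv (shift G i j).
  move=> ij [Gk iG cG dG lG] nij.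
  have G'k : uniform k (shift G i j) by apply: uniform_shift.
  have iG' : intersecting (shift G i j) by apply: intersecting_shift.
  have nE : neither (shift G i j) i j = neither G i j.
    by apply: num_shift => A jA iA; rewrite !inE eqxx jA andbF.
  (* The members avoiding both [i] and [j] survive the shift, and they alone keep [i] and [j]
     avoided often enough. *)
  have d' v : 12 * u < avoid (shift G i j) v.
    case: (eqVneq v i) => [->|vi]; first by rewrite (avoidE _ i j) nE; lia.
    case: (eqVneq v j) => [->|vj]; first by rewrite (avoidE _ j i) neitherC nE; lia.
    rewrite /avoid num_shift => [|A _ _]; [exact: dG|by rewrite mem_swap].
  split=> //; first by rewrite card_shift.
  move=> x y xy; rewrite leqNgt; apply/negP=> hxy.
  have [v [vx vy hxv hyv]] := heavy_triangle k0 nk G'k iG' d' xy hxy.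
  (* Some edge of the heavy triangle misses [i], and pairs missing [i] gain nothing from the
     shift. *)
  have absurd (a b : 'I_n) : a != b -> a != i -> b != i -> 4 * u < both (shift G i j) a b -> False.
    move=> ab ai bi; rewrite ltnNge => /negP; apply.
    exact: leq_trans (both_shift_leq G ij ai bi) (lG a b ab).
  case: (eqVneq x i) => xi; last case: (eqVneq y i) => yi.
  - by apply: (absurd y v) => //; rewrite -?xi // eq_sym.
  - by apply: (absurd x v) => //; rewrite -?yi // eq_sym.
  - exact: (absurd x y).
(* The second alternative does not mention [G]: once stuck, it is carried unchanged through all
   further shifts. *)
have [] : exists2 G, inv G \/ (exists G' (x y : 'I_n), [/\ x != y, inv G' &
    neither G' x y <= 12 * u]) & shifted setT G.
  apply: (@shift_ind n setT _ _ F); last by left.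
  move=> G i j _ _ ij [iG|]; last by right.
  have nij : i != j by rewrite neq_ltn ij.
  case: (leqP (neither G i j) (12 * u)) => h; first by right; exists G, i, j.
  by left; apply: inv_shift.
move=> G [[Gk iG cG dG lG]|[G' [x [y [xy invG' nxy]]]]] sG.
  by have [v] := shifted_full k0 nk Gk iG sG lG; have := dG v; rewrite -/u; lia.
have [||H [[Hk iH cH dH lH] nH] sH] :=
    @shift_ind n (~: [set x; y]) (fun H => inv H /\ neither H x y <= 12 * u) _ G'.
- move=> H i j iU jU ij [invH nH]; have [_ _ _ nE] := cells_shift H iU jU.
  have nij : i != j by rewrite neq_ltn ij.
  split; last by rewrite nE.
  apply: inv_shift => //; rewrite ltnNge; apply/negP=> hij.
  case: invH => _ _ cH _ lH.
  (* If [i], [j] were stuck too, the right side would be at most [12u + 12u + 4 * 4u = 40u], too few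
     for a nonempty family of size at least [48u]. *)
  have : #|H| <= neither H x y + neither H i j + both H x i + both H x j + both H y i + both H y j.
    rewrite -sum1_card /neither /both /num -!big_split; apply: leq_sum => A _ /=.
    by case: (x \in A); case: (y \in A); case: (i \in A); case: (j \in A).
  move: iU jU; rewrite !inE !negb_or => /andP[ix iy] /andP[jx jy].
  have [xi yi xj yj] : [/\ x != i, y != i, x != j & y != j].
    by rewrite ![x == _]eq_sym ![y == _]eq_sym.
  move: (lH _ _ xi) (lH _ _ yi) (lH _ _ xj) (lH _ _ yj) nH hij hF Fpos; rewrite cH.
  by clear; lia.
- by split.
(* Otherwise [only H b a] is at most [u] and [neither H a b] at most [2u], so [a] is avoided by at
   most [3u] members. *)
have small (a b : 'I_n) : a != b -> shifted (~: [set a; b]) H -> only H a b <= 9 * u.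
  move=> ab sab; rewrite leqNgt; apply/negP=> oab.
  have [||ob nab] := only_dichotomy k0 nk Hk iH ab sab.
  - by move=> v va _; apply: lH; rewrite eq_sym.
  - exact: oab.
  by have := dH a; rewrite (avoidE H a b); lia.
have oxy := small x y xy sH.
have oyx : only H y x <= 9 * u by apply: small; rewrite 1?eq_sym // setUC.
(* The four cells add up to at most [4u + 9u + 9u + 12u = 34u]. *)
by have := lH x y xy; have := card_cells H x y; lia.
Qed.

(** * Degrees and the conclusion *)

Lemma card_link (n : nat) (F : {set {set 'I_n}}) (i : 'I_n) :
  #|F| = avoid F i + #|link F i|.
Proof.
rewrite /link card_in_imset => [|A B]; last first.
  by rewrite !inE => /andP[_ iA] /andP[_ iB] E; rewrite -(setD1K iA) E setD1K.
transitivity (avoid F i + num F (fun A => i \in A)); last first.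
  by rewrite num_card; congr (_ + _); apply: eq_card => A; rewrite !inE.
rewrite -sum1_card /avoid /num -big_split; apply: eq_bigr => A _ /=.
by case: (i \in A).
Qed.

(** A member missing m of the three vertices is counted m times on the side of [avoid], and m is at
    most 1 + C(m,2). *)
Lemma double_card_triangle (n : nat) (F : {set {set 'I_n}}) (x y z : 'I_n) :
  2 * #|F| <= #|link F x| + #|link F y| + #|link F z| +
              neither F x y + neither F x z + neither F y z.
Proof.
have : avoid F x + avoid F y + avoid F z <= #|F| + neither F x y + neither F x z + neither F y z.
  rewrite -sum1_card /avoid /neither /num -!big_split; apply: leq_sum => A _ /=.
  by case: (x \in A); case: (y \in A); case: (z \in A).
have := card_link F x; have := card_link F y; have := card_link F z; lia.
Qed.

Local Open Scope ring_scope.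

Theorem mainTheorem3 (R : realFieldType) (eps : R) (n k : nat) (F : {set {set 'I_n}}) :
  0 < eps -> eps <= 1 / 24%:R ->
  (0 < n)%N -> (0 < k)%N ->
  k%:R / eps <= n%:R ->
  uniform k F -> intersecting F -> F != set0 ->
  (#|F| >= 48 * binom_m3 n k)%N ->
  2%:R / 3%:R - eps < rho R F.
Proof.
move=> eps0 eps24 n0 k0 nk Fk iF F0.
rewrite [binom_m3 n k]/(cb (n - 3) k 3) => hF.
rewrite ltNge; apply/negP=> small_rho.
have Fpos : 0 < #|F|%:R :> R by rewrite ltr0n card_gt0.
set N : R := #|F|%:R in Fpos.
have epsN : 0 < eps * N by apply: mulr_gt0.
have kn : k%:R <= eps * n%:R by rewrite mulrC -ler_pdivrMr.
have degree i : #|link F i|%:R <= 2%:R / 3%:R * N - eps * N.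
  rewrite -mulrBl -ler_pdivrMr //; apply: le_trans small_rho.
  exact: (le_bigmax 0 (fun i => #|link F i|%:R / N : R) i).
have nk24 : (24 * k <= n)%N.
  rewrite -(ler_nat R) natrM; have n0R : 0 <= n%:R :> R by exact: ler0n.
  have : eps * n%:R <= 1 / 24%:R * n%:R by apply: ler_wpM2r.
  by move: kn; lra.
(* More than a third of the family avoids [v], and [3 * 12u <= 48u]. *)
have avoid_gt v : (12 * cb (n - 3) k 3 < avoid F v)%N.
  suff lt : (#|F| < 3 * avoid F v)%N.
    rewrite -(@ltn_pmul2l 3) // mulnA; apply: leq_ltn_trans lt; apply: leq_trans hF.
    by rewrite leq_mul2r orbT.
  rewrite -(ltr_nat R) natrM; have := degree v.
  have : N = (avoid F v)%:R + #|link F v|%:R by rewrite -natrD -card_link.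
  by rewrite -/N; lra.
have [x [y [xy hxy]]] := heavy_pair k0 nk24 Fk iF F0 hF avoid_gt.
have [v [vx vy hxv hyv]] := heavy_triangle k0 nk24 Fk iF avoid_gt xy hxy.
have xv : x != v by rewrite eq_sym.
have yv : y != v by rewrite eq_sym.
have T1 := neither_of_heavy k0 nk24 Fk iF xy hxy.
have T2 := neither_of_heavy k0 nk24 Fk iF xv hxv.
have T3 := neither_of_heavy k0 nk24 Fk iF yv hyv.
have := cb_n2k4 nk24; set T := cb (n - 2) k 4 in T1 T2 T3 *.
set u := cb (n - 3) k 3 in hF * => nT.
have sum2 : (2 * #|F| <= #|link F x| + #|link F y| + #|link F v| + T + T + T)%N.
  by apply: leq_trans (double_card_triangle F x y v) _; rewrite !leq_add.
(* The three degrees sum to at most [(2 - 3 * eps) * N] and to at least [2 * N - 3 * T]. *)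
have epsT : eps * N <= T%:R.
  move: sum2; rewrite -(ler_nat R) natrM !natrD -/N.
  by have := degree x; have := degree y; have := degree v; lra.
have nR : 0 < n%:R :> R by rewrite ltr0n.
have Tu : T%:R <= 3%:R * eps * u%:R :> R.
  rewrite -(ler_pM2l nR); move: nT; rewrite -(ler_nat R) !natrM => /le_trans; apply.
  rewrite mulrA; apply: ler_wpM2r; first exact: ler0n.
  by move: kn; lra.
(* Cancelling [eps] in [eps * N <= T <= 3 * eps * u] contradicts [48 * u <= N], as [N] is
   positive. *)
have uN : N <= 3%:R * u%:R.
  by rewrite -(ler_pM2l eps0) (le_trans epsT) // (le_trans Tu) // mulrCA mulrA.
have hFR : 48%:R * u%:R <= N by rewrite -natrM ler_nat.
by move: Fpos; lra.
Qed.
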